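(* Let $\mathbb{C}$ be an initial configuration of the block set $\mathbb{B}=\{1,\dots,B\}$ on $S$ stacks, and for $k=1,2$ let $\{\mathbb{B}^k_i : i=1,\dots,n_k\}$ be a partition of $\mathbb{B}$. Then the following inequalities hold: $$f^{\mathrm{mt}}(\mathbb{B}) \ge \sum_{i=1}^{n_1} f^{\mathrm{mt}}(\mathbb{B}^1_i)\qquad \text{for every } \mathrm{mt}\in\{\mathrm{BB},\mathrm{BG},\mathrm{GB},\mathrm{GG}\},$$ $$f^{\overline{\mathrm{BG}}}(\mathbb{B}) \ge \sum_{i=1}^{n_1} f^{\overline{\mathrm{BG}}}(\mathbb{B}^1_i) \ge \sum_{i=1}^{n_1}\left( f^{\mathrm{BB}}(\mathbb{B}^1_i)+f^{\mathrm{GB}}(\mathbb{B}^1_i)+f^{\mathrm{GG}}(\mathbb{B}^1_i)\right),$$ $$f(\mathbb{B}) \ge f^{\mathrm{BG}}(\mathbb{B}) + f^{\overline{\mathrm{BG}}}(\mathbb{B}) \ge \sum_{i=1}^{n_1} f^{\mathrm{BG}}(\mathbb{B}^1_i)+\sum_{i=1}^{n_2} f^{\overline{\mathrm{BG}}}(\mathbb{B}^2_i).$$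
   Context: Setting (block relocation problem). There are $S$ stacks and $B$ blocks labelled by $\mathbb{B}=\{1,\dots,B\}$; a smaller label means a higher priority (earlier retrieval). A configuration places blocks in the stacks, each stack being a finite vertical sequence of blocks; the initial configuration $\mathbb{C}$ contains every block exactly once. A stack height limit $H$ may be imposed (each stack holds at most $H$ blocks; $H=\infty$ if there is no limit). Two kinds of moves exist. A relocation takes the topmost block of a stack and puts it on top of a different stack (respecting the height limit). A retrieval removes from the bay the block of smallest label among those still present, and is allowed only if that block is topmost in its stack. A feasible move sequence is a finite sequence of moves starting from $\mathbb{C}$ after which all blocks have been retrieved; it is assumed that at least one exists. It is also assumed that no block is directly retrievable in $\mathbb{C}$ (i.e. block $1$ is not topmost). In a given configuration, a block is badly placed (BP) if some block below it in the same stack has higher priority (smaller label); otherwise it is well placed (WP). A relocation is a BB, BG, GB or GG move, where the first letter is B (resp. G) if the moved block is BP (resp. WP) just before the move, and the second letter is B (resp. G) if it is BP (resp. WP) just after the move. A non-BG move is a BB, GB or GG move. For $\mathtt{B}\subseteq\mathbb{B}$: $f(\mathtt{B})$ is the minimum, over all feasible move sequences for $\mathbb{C}$, of the number of relocations implemented on blocks of $\mathtt{B}$. For $\mathrm{mt}\in\{\mathrm{BB},\mathrm{BG},\mathrm{GB},\mathrm{GG}\}$, $f^{\mathrm{mt}}(\mathtt{B})$ is the minimum, over all feasible move sequences, of the number of relocations of type mt implemented on blocks of $\mathtt{B}$. $f^{\overline{\mathrm{BG}}}(\mathtt{B})$ is the minimum, over all feasible move sequences, of the number of non-BG moves implemented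 on blocks of $\mathtt{B}$. (The minima are taken independently of one another.) *)

(* Defs.v *)
From HB Require Import structures.
From mathcomp Require Import all_boot.
From mathcomp Require Import boolp.

Set Implicit Arguments.
Unset Strict Implicit.
Unset Printing Implicit Defensive.

(* Block label k + 1 is the ordinal k, so the order on 'I_B is the priority
   order.  A stack lists its blocks from top to bottom: its head is the topmost
   block.  A height limit [None] means that there is no limit. *)
Definition config (S B : nat) := {ffun 'I_S -> seq 'I_B}.

Inductive move (S : nat) :=
  | Relocate of 'I_S & 'I_S
  | Retrieve of 'I_S.

Inductive move_type := BB | BG | GB | GG.

Lemma move_type_comparable : comparable move_type.
Proof. by rewrite /comparable /decidable; decide equality. Qed.

HB.instance Definition _ := hasDecEq.Build move_type
  (compareP move_type_comparable).

Section BlockRelocation.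
Variables S B : nat.
Implicit Types (H : option nat) (c : config S B) (s t : 'I_S) (b : 'I_B).
Implicit Types (m : move S) (ms : seq (move S)) (A : {set 'I_B}).

Definition within H (h : nat) : bool := if H is Some h' then h <= h' else true.

Definition present c b : bool := [exists s, b \in c s].

Definition empty_config : config S B := [ffun=> [::]].

Definition initial_config H c : Prop :=
  (forall b, \sum_(s < S) count_mem b (c s) = 1) /\
  (forall s, within H (size (c s))).

Definition badly_placed c b : bool :=
  [exists s, (b \in c s) &&
     has (fun b' : 'I_B => b' < b) (drop (index b (c s)).+1 (c s))].

Definition retrievable c s : bool :=
  if c s is b :: _ then [forall b', present c b' ==> (b <= b')] else false.

Definition step H c m : option (config S B) :=
  match m with
  | Relocate s t =>
      if c s is b :: l then
        if (s != t) && within H (size (c t)).+1 then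
          Some [ffun u => if u == s then l
                          else if u == t then b :: c t else c u]
        else None
      else None
  | Retrieve s =>
      if retrievable c s then
        Some [ffun u => if u == s then behead (c s) else c u]
      else None
  end.

Fixpoint run H c ms : option (config S B) :=
  if ms is m :: ms' then
    if step H c m is Some c' then run H c' ms' else None
  else Some c.

Definition feasible H c ms : Prop := run H c ms = Some empty_config.

Definition relocation_type c c' b : move_type :=
  match badly_placed c b, badly_placed c' b with
  | true, true => BB
  | true, false => BG
  | false, true => GB
  | false, false => GG
  end.

(* [c'] is the configuration reached from [c] by the move [m]. *)
Definition counted (T : pred move_type) A c m c' : bool :=
  if m is Relocate s _ then
    if c s is b :: _ then (b \in A) && T (relocation_type c c' b) else false
  else false.

Fixpoint count_relocations H (T : pred move_type) A c ms : nat :=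
  if ms is m :: ms' then
    if step H c m is Some c' then
      counted T A c m c' + count_relocations H T A c' ms'
    else 0
  else 0.

Definition attained H c (T : pred move_type) A : pred nat :=
  fun n => `[< exists ms, feasible H c ms /\
                          count_relocations H T A c ms = n >].

Lemma attained_nonempty H c (T : pred move_type) A :
  (exists ms, feasible H c ms) -> exists n, attained H c T A n.
Proof.
by case=> ms fms; exists (count_relocations H T A c ms); apply/asboolP; exists ms.
Qed.

Definition min_relocations H c (hf : exists ms, feasible H c ms)
    (T : pred move_type) A : nat :=
  ex_minn (attained_nonempty T A hf).

Definition f_all H c (hf : exists ms, feasible H c ms) A : nat :=
  min_relocations hf predT A.

Definition f_type H c (hf : exists ms, feasible H c ms) (mt : move_type) A :
    nat :=
  min_relocations hf (pred1 mt) A.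

Definition f_nonBG H c (hf : exists ms, feasible H c ms) A : nat :=
  min_relocations hf [pred mt | mt \in [:: BB; GB; GG]] A.

Definition partition_family (n : nat) (P : 'I_n -> {set 'I_B}) : Prop :=
  injective P /\ partition [set P i | i : 'I_n] [set: 'I_B].

End BlockRelocation.

(* Main.v *)
(* Every minimum is bounded by the count along any one feasible sequence.  Evaluate
   all of them along a sequence that is optimal for the larger quantity: along a
   fixed sequence, counts are additive over disjoint block sets and over disjoint
   sets of move types. *)
Require Import Defs.
From mathcomp Require Import all_boot.
From mathcomp Require Import boolp.

Set Implicit Arguments.
Unset Strict Implicit.
Unset Printing Implicit Defensive.

(** Covering supplies one index whose part contains [b], and disjointness rules out the others.
    Since [partition] only sees the set of parts, injectivity of [P] is what prevents one part from
    being counted under two indices. *)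
Lemma sum_mem_partition_family (B n : nat) (P : 'I_n -> {set 'I_B}) (b : 'I_B) :
  partition_family P -> \sum_(i < n) (b \in P i) = 1.
Proof.
case=> injP /and3P[/eqP covP trivP _].
have: b \in cover [set P i | i : 'I_n] by rewrite covP in_setT.
case/bigcupP=> _ /imsetP[i _ ->] bPi.
rewrite (bigD1 i) //= bPi big1 // => j neq_ji.
have /(trivIsetP trivP) : P i \in [set P i | i : 'I_n] by apply: imset_f.
move=> /(_ (P j) (imset_f _ _)) /= /(_ isT).
rewrite (inj_eq injP) eq_sym neq_ji => /(_ isT) /pred0P/(_ b) /=.
by rewrite bPi /= => ->.
Qed.

Section Counting.
Variables (S B : nat) (H : option nat).
Implicit Types (c : config S B) (ms : seq (move S)) (T : pred move_type).
Implicit Type A : {set 'I_B}.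

(** Each relocation moves a single block, and that block lies in exactly one part, so it contributes
    once to the sum. *)
Lemma sum_count_partition_family T n (P : 'I_n -> {set 'I_B}) c ms :
  partition_family P ->
  \sum_(i < n) count_relocations H T (P i) c ms =
  count_relocations H T [set: 'I_B] c ms.
Proof.
move=> hP; elim: ms c => [|m ms IH] c /=; first by rewrite big1.
(* An illegal move makes every count 0, so the identity needs no feasibility of [ms]. *)
case: (step H c m) => [c'|]; last by rewrite big1.
rewrite big_split /= IH; congr addn.
case: m => [s t|s] /=; last by rewrite big1.
case: (c s) => [|b l]; first by rewrite big1.
rewrite in_setT /=; case: (T _); last by rewrite big1 // => i _; rewrite andbF.
by rewrite -[RHS](sum_mem_partition_family b hP); apply: eq_bigr => i _; rewrite andbT.
Qed.

(** With booleans read as 0 or 1, [hT] says that [T] is the disjoint union of [T1] and [T2]; the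
    type of each counted relocation then satisfies at most one of them. *)
Lemma count_relocationsD T1 T2 T A c ms :
  (forall mt, T1 mt + T2 mt = T mt) ->
  count_relocations H T1 A c ms + count_relocations H T2 A c ms =
  count_relocations H T A c ms.
Proof.
move=> hT; elim: ms c => [|m ms IH] c //=.
case: (step H c m) => [c'|] //; rewrite addnACA IH; congr addn.
case: m => [s t|s] //=; case: (c s) => [|b l] //.
by case: (b \in A) => //=.
Qed.

Lemma min_relocations_le c (hf : exists ms, feasible H c ms) T A ms :
  feasible H c ms -> min_relocations hf T A <= count_relocations H T A c ms.
Proof.
move=> fms; rewrite /min_relocations; case: ex_minnP => k _; apply.
by apply/asboolP; exists ms.
Qed.

Lemma min_relocations_attained c (hf : exists ms, feasible H c ms) T A :
  exists2 ms, feasible H c ms &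
    count_relocations H T A c ms = min_relocations hf T A.
Proof.
rewrite /min_relocations; case: ex_minnP => k /asboolP[ms [fms eq_k]] _.
by exists ms.
Qed.

Lemma min_relocations_partition c (hf : exists ms, feasible H c ms) T n
    (P : 'I_n -> {set 'I_B}) :
  partition_family P ->
  \sum_(i < n) min_relocations hf T (P i) <= min_relocations hf T [set: 'I_B].
Proof.
move=> hP; have [ms fms <-] := min_relocations_attained hf T [set: 'I_B].
rewrite -(sum_count_partition_family _ _ _ hP).
by apply: leq_sum => i _; apply: min_relocations_le.
Qed.

Lemma min_relocationsD c (hf : exists ms, feasible H c ms) T1 T2 T A :
  (forall mt, T1 mt + T2 mt = T mt) ->
  min_relocations hf T1 A + min_relocations hf T2 A <= min_relocations hf T A.
Proof.
move=> hT; have [ms fms <-] := min_relocations_attained hf T A.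
by rewrite -(count_relocationsD _ _ _ hT) leq_add ?min_relocations_le.
Qed.

End Counting.

Theorem theorem2 (S B : nat) (H : option nat) (C : config S B)
  (hC : initial_config H C)
  (hretr : forall s : 'I_S, ~~ retrievable C s)
  (hfeas : exists ms : seq (move S), feasible H C ms)
  (n1 n2 : nat) (P1 : 'I_n1 -> {set 'I_B}) (P2 : 'I_n2 -> {set 'I_B})
  (hP1 : partition_family P1) (hP2 : partition_family P2) :
  (forall mt : move_type,
     f_type hfeas mt [set: 'I_B] >= \sum_(i < n1) f_type hfeas mt (P1 i))
  /\ (f_nonBG hfeas [set: 'I_B] >= \sum_(i < n1) f_nonBG hfeas (P1 i)
      /\ \sum_(i < n1) f_nonBG hfeas (P1 i) >=
         \sum_(i < n1) (f_type hfeas BB (P1 i) + f_type hfeas GB (P1 i)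
                        + f_type hfeas GG (P1 i)))
  /\ (f_all hfeas [set: 'I_B] >=
        f_type hfeas BG [set: 'I_B] + f_nonBG hfeas [set: 'I_B]
      /\ f_type hfeas BG [set: 'I_B] + f_nonBG hfeas [set: 'I_B] >=
         \sum_(i < n1) f_type hfeas BG (P1 i)
         + \sum_(i < n2) f_nonBG hfeas (P2 i)).
Proof.
split; first by move=> mt; apply: min_relocations_partition.
split; split.
- exact: min_relocations_partition.
- apply: leq_sum => i _.
  (* Three types are merged by two uses of the binary inequality: first BB with GB, then the result
     with GG. *)
  have le_BB_GB : f_type hfeas BB (P1 i) + f_type hfeas GB (P1 i) <=
      min_relocations hfeas [pred mt | mt \in [:: BB; GB]] (P1 i).
    by apply: min_relocationsD; case; rewrite /= ?inE; do ?case: eqP.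
  apply: leq_trans (leq_add le_BB_GB (leqnn _)) _.
  by apply: min_relocationsD; case; rewrite /= ?inE; do ?case: eqP.
(* BG and non-BG are complementary, so together they make up [predT]. *)
- by apply: min_relocationsD; case; rewrite /= ?inE; do ?case: eqP.
(* The two minima are bounded separately, which is why each may use its own partition. *)
- by apply: leq_add; apply: min_relocations_partition.
Qed.
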